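(* There exists a family of cubic 3-connected Hamiltonian-transitive graphs with an unbounded number of edge orbits; that is, for every $N\in\mathbb{N}$ the family contains a graph with at least $N$ edge orbits.
   Context: All graphs are finite, simple and undirected. Cubic means 3-regular. A Hamiltonian cycle is a cycle (of length at least 3) through all vertices, identified with its edge set. A graph is Hamiltonian-transitive if it has a Hamiltonian cycle and for every pair of Hamiltonian cycles there is an automorphism of the graph mapping one to the other. An edge orbit of a graph $G$ is an orbit of the action of the automorphism group $\operatorname{Aut}(G)$ on the edge set $E(G)$. *)

(* Defs.v *)
From mathcomp Require Import all_boot all_fingroup.

Set Implicit Arguments.
Unset Strict Implicit.
Unset Printing Implicit Defensive.

Import GroupScope.

Record sgraph := SGraph {
  vertex :> finType;
  adj : rel vertex;
  adj_sym : symmetric adj;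
  adj_irrefl : irreflexive adj
}.

Section GraphDefs.
Variable G : sgraph.

Definition edges : {set {set G}} :=
  [set [set p.1; p.2] | p : G * G & adj p.1 p.2].

Definition cubic : Prop := forall x : G, #|[set y | adj x y]| = 3.

Definition adj_avoiding (S : {set G}) : rel G :=
  [rel x y | [&& x \notin S, y \notin S & adj x y]].

Definition k_connected (k : nat) : Prop :=
  k < #|G| /\
  forall S : {set G}, #|S| < k ->
    {in ~: S &, forall x y, connect (adj_avoiding S) x y}.

Definition graph_aut : {set {perm G}} :=
  [set s : {perm G} | [forall x, forall y, adj (s x) (s y) == adj x y]].

Lemma graph_autP (s : {perm G}) :
  reflect (forall x y, adj (s x) (s y) = adj x y) (s \in graph_aut).
Proof.
rewrite inE; apply: (iffP forallP) => [H x y | H x].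
  by have /forallP/(_ y)/eqP := H x.
by apply/forallP => y; rewrite H.
Qed.

Lemma graph_aut_group_set : group_set graph_aut.
Proof.
apply/group_setP; split=> [|s t /graph_autP Hs /graph_autP Ht].
  by apply/graph_autP => x y; rewrite !perm1.
by apply/graph_autP => x y; rewrite !permM Ht Hs.
Qed.

Canonical graph_aut_group : {group {perm G}} := Group graph_aut_group_set.

(* The action of permutations on vertices, lifted to sets of vertices, so that
   an edge [set x; y] is sent to [set s x; s y]. *)
Definition edge_orbits : {set {set {set G}}} :=
  [set orbit ('P^* )%act graph_aut e | e in edges].

Definition cycle_edges (c : seq G) : {set {set G}} :=
  [set [set x; next c x] | x in c].

(* The length bound matters: [ucycle] also accepts the empty sequence and the
   2-vertex walk back and forth along an edge. *)
Definition hamiltonian_cycle (C : {set {set G}}) : Prop :=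
  exists c : seq G,
    [/\ 2 < size c, ucycle (@adj G) c, (forall x, x \in c) & C = cycle_edges c].

(* The vertex action is lifted twice: C is a set of edges. *)
Definition hamiltonian_transitive : Prop :=
  (exists C, hamiltonian_cycle C) /\
  forall C D, hamiltonian_cycle C -> hamiltonian_cycle D ->
    exists2 s, s \in graph_aut & ('P^*^* )%act C s = D.

End GraphDefs.

(* Main.v *)
(** Let T(G) be the truncation of a cubic graph G: every vertex is replaced by a
    triangle, so that the vertices of T(G) are the darts of G.  Truncation
    preserves being cubic and 3-connected.  A Hamiltonian cycle of T(G) enters
    and leaves every triangle exactly once and uses the two triangle edges that
    do not join its two ends, so contracting the triangles is a bijection onto
    the Hamiltonian cycles of G; as automorphisms of G lift, Hamiltonian
    transitivity is inherited by T(G).  The edges of T(G) coming from G lie in no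
    triangle, hence automorphisms of T(G) preserve the triangles of the truncation
    and descend to G: T(G) has at least one more edge orbit than G.  Iterate,
    starting from K4. *)

Require Import Defs.
From mathcomp Require Import all_boot all_fingroup.

Set Implicit Arguments.
Unset Strict Implicit.
Unset Printing Implicit Defensive.

Import GroupScope.

Lemma set2_eqP (T : finType) (a b c d : T) :
  [set a; b] = [set c; d] <-> (a = c /\ b = d) \/ (a = d /\ b = c).
Proof.
split=> [E|[[-> ->]|[-> ->]]] //; last exact: setUC.
have: a \in [set c; d] by rewrite -E set21.
have: b \in [set c; d] by rewrite -E set22.
have: c \in [set a; b] by rewrite E set21.
have: d \in [set a; b] by rewrite E set22.
rewrite !inE => /orP[] /eqP h1 /orP[] /eqP h2 /orP[] /eqP h3 /orP[] /eqP h4;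
  subst; auto.
Qed.

(** * Hamiltonian cycles as transitive successor functions *)

Section SuccessorFunctions.
Variables (T : finType) (f : T -> T).
Hypothesis f_trans : forall x y, fconnect f x y.

Lemma fclosed_full (A : {set T}) (x : T) :
  x \in A -> {in A, forall y, f y \in A} -> forall y, y \in A.
Proof.
move=> xA fA y; have /iter_findex <- := f_trans x y.
by elim: (findex f x y) => //= n IH; apply: fA.
Qed.

(** Any [y] is reached from some [x != y] by at least one step, hence is a value of [f]; on a finite
    type surjectivity gives injectivity. *)
Lemma transitive_inj : 1 < #|T| -> injective f.
Proof.
move=> T1; suff im : #|codom f| = #|T|.
  by apply/injectiveP; apply/card_uniqP; rewrite im size_codom.
apply/eqP; rewrite eqn_leq max_card /=; apply/subset_leq_card/subsetP => y _.
have [x xy] : exists x, x != y.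
  have /card_gt0P[x] : 0 < #|[set~ y]| by rewrite cardsC1; case: #|T| T1 => [|[]].
  by rewrite !inE => xy; exists x.
have /iter_findex := f_trans x y; case: (findex f x y) => [/= E|n <-].
  by rewrite E eqxx in xy.
by rewrite iterS codom_f.
Qed.

Lemma transitive_no_2cycle : 2 < #|T| -> forall x, f (f x) != x.
Proof.
move=> T2 x; apply/eqP => E.
have /subset_leq_card : [set: T] \subset [set x; f x].
  apply/subsetP => y _; apply: (@fclosed_full [set x; f x] x); first exact: set21.
  by move=> z; rewrite !inE => /orP[]/eqP->; rewrite ?E eqxx ?orbT.
by rewrite cardsT cards2 leqNgt; case: (_ != _) => /=; rewrite ?T2 ?(ltnW T2).
Qed.

End SuccessorFunctions.

Section HamiltonianSuccessor.
Variable G : sgraph.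

(** Trades the vertex sequence for a successor map, so that cycles can be studied locally, triangle
    by triangle. One way uses [next c], the other the [f]-orbit of any vertex. *)
Lemma hamiltonian_cycleP (C : {set {set G}}) :
  hamiltonian_cycle C <->
  2 < #|G| /\ exists f : G -> G,
    [/\ forall x, adj x (f x), forall x y, fconnect f x y
      & C = [set [set x; f x] | x : G]].
Proof.
split=> [[c [c2 /andP[cyc uc] allc ->]]|[G2 [f [fadj ftr ->]]]].
  split.
    rewrite cardE; apply: leq_trans c2 _.
    by apply: uniq_leq_size uc _ => x _; rewrite mem_enum.
  exists (next c); split=> [x|x y|].
  - exact: next_cycle cyc (allc x).
  - by rewrite (fconnect_cycle (cycle_next uc) (allc x)) allc.
  - apply/setP => e; apply/imsetP/imsetP => -[x _ ->]; exists x => //.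
have finj := transitive_inj ftr (ltnW G2).
have /card_gt0P[x0 _] : 0 < #|G| by apply: leq_trans G2.
have allc (x : G) : x \in fingraph.orbit f x0 by rewrite -fconnect_orbit.
have fc := cycle_orbit finj x0.
exists (fingraph.orbit f x0); split=> //.
- apply: leq_trans G2 _; rewrite cardE.
  by apply: uniq_leq_size (enum_uniq _) _ => x _; apply: allc.
- apply/andP; split; last exact: orbit_uniq.
  by apply: sub_cycle fc => x y /= /eqP <-.
- apply/setP => e; apply/imsetP/imsetP => -[x _ ->]; exists x => //;
    by have /eqP -> := next_cycle fc (allc x).
Qed.

End HamiltonianSuccessor.

Lemma adj_avoiding_sym (G : sgraph) (S : {set G}) : symmetric (adj_avoiding S).
Proof. by move=> x y; rewrite /adj_avoiding /= adj_sym andbCA. Qed.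

(** * The truncation of a cubic graph: degree and connectivity *)

Section Truncation.
Variable G : sgraph.

Definition dart := {p : G * G | adj p.1 p.2}.
Definition tail (d : dart) : G := (val d).1.
Definition head (d : dart) : G := (val d).2.
Definition Dart (u v : G) (uv : adj u v) : dart := exist _ (u, v) uv.

Lemma adj_dart (d : dart) : adj (tail d) (head d).
Proof. exact: (valP d). Qed.

Lemma dart_eqP (d d' : dart) : tail d = tail d' -> head d = head d' -> d = d'.
Proof.
rewrite /tail /head => t h; apply: val_inj.
by case: (val d) (val d') t h => [? ?] [? ?] /= -> ->.
Qed.

Lemma adj_rev (d : dart) : adj (head d) (tail d).
Proof. by rewrite adj_sym adj_dart. Qed.

Definition rev_dart (d : dart) : dart := Dart (adj_rev d).

Lemma rev_dartK : involutive rev_dart.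
Proof. by move=> d; apply: dart_eqP. Qed.

Lemma tail_neq_head (d : dart) : tail d != head d.
Proof. by apply/eqP => E; have := adj_dart d; rewrite E adj_irrefl. Qed.

Lemma tail_rev (d : dart) : tail (rev_dart d) <> tail d.
Proof. by move=> E; have := tail_neq_head d; rewrite -E eqxx. Qed.

(** The first disjunct gives the triangle edges, the second the copies of the edges of [G]. *)
Definition trunc_adj (d d' : dart) : bool :=
  (tail d == tail d') && (d != d') || (d' == rev_dart d).

Lemma trunc_adj_sym : symmetric trunc_adj.
Proof.
move=> d d'; rewrite /trunc_adj eq_sym (eq_sym d).
by congr (_ || _); apply/eqP/eqP => ->; rewrite rev_dartK.
Qed.

Lemma trunc_adj_irrefl : irreflexive trunc_adj.
Proof.
move=> d; by rewrite /trunc_adj !eqxx /=; apply/eqP => /(congr1 tail)/esym/tail_rev.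
Qed.

Definition trunc : sgraph := SGraph trunc_adj_sym trunc_adj_irrefl.

Lemma trunc_adj_rev (d : dart) : adj (d : trunc) (rev_dart d).
Proof. by rewrite /= /trunc_adj eqxx orbT. Qed.

Definition cluster (u : G) : {set dart} := [set d | tail d == u].

Hypothesis cubicG : cubic G.

Lemma card_cluster (u : G) : #|cluster u| = 3.
Proof.
rewrite -(cubicG u) -(card_in_imset (f := head) (D := cluster u)).
  apply: eq_card => v; apply/imsetP/idP => [[d]|].
    by rewrite !inE => /eqP <- ->; apply: adj_dart.
  by rewrite inE => uv; exists (Dart uv); rewrite // inE.
by move=> d d'; rewrite !inE => /eqP t /eqP t' h; apply: dart_eqP; rewrite // t t'.
Qed.

Lemma third_dart (d d' : dart) : tail d = tail d' -> d != d' ->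
  exists t, [/\ tail t = tail d, t != d, t != d' &
    forall x, tail x = tail d -> [\/ x = d, x = d' | x = t]].
Proof.
move=> tt dd'.
have : #|cluster (tail d) :\ d :\ d'| == 1%N.
  have := card_cluster (tail d).
  rewrite (cardsD1 d) (cardsD1 d' (_ :\ _)) !inE eqxx (eq_sym d') dd' -tt eqxx /=.
  by move/eqP; rewrite !add1n !eqSS.
case/cards1P => t /setP E.
have := E t; rewrite !inE eqxx => /and3P[td' td /eqP tail_t].
exists t; split=> // x tx; have := E x; rewrite !inE tx eqxx andbT.
have [->|_] := eqVneq x d'; first by constructor 2.
have [->|_ /=] := eqVneq x d; first by constructor 1.
by move/esym/eqP->; constructor 3.
Qed.

Lemma dart_at (u : G) : exists d, tail d == u.
Proof.
have /card_gt0P[d] : 0 < #|cluster u| by rewrite card_cluster.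
by rewrite inE => ud; exists d.
Qed.

Lemma other_dart (d : dart) : exists2 d', tail d' = tail d & d' != d.
Proof.
have /card_gt0P[d'] : 0 < #|cluster (tail d) :\ d|.
  by have := card_cluster (tail d); rewrite (cardsD1 d) !inE eqxx add1n => -[->].
by rewrite !inE => /andP[dd' /eqP tt]; exists d'.
Qed.

Lemma trunc_cubic : cubic trunc.
Proof.
move=> d; rewrite (_ : [set y | _] = rev_dart d |: (cluster (tail d) :\ d)).
  have := card_cluster (tail d); rewrite cardsU1
    (cardsD1 d (cluster _)) !inE eqxx add1n => -[->].
  by rewrite (introF eqP (@tail_rev d)) andbF.
apply/setP => y; rewrite !inE /= /trunc_adj.
by rewrite (eq_sym y d) (eq_sym (tail y)) orbC andbC.
Qed.


Lemma card_cubic (x : G) : 3 < #|G|.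
Proof.
rewrite -(cubicG x) -cardsT; apply: proper_card.
by rewrite properT; apply/eqP => /setP/(_ x); rewrite !inE adj_irrefl.
Qed.

Lemma leq_card_trunc : #|G| <= #|{: dart}|.
Proof.
rewrite -cardsT (_ : [set: G] = tail @: [set: dart]).
  by rewrite -[#|{: dart}|]cardsT leq_imset_card.
apply/setP => u; rewrite inE; apply/esym/imsetP.
by have [d /eqP ud] := dart_at u; exists d.
Qed.

(** Deleting [S] spoils at most two clusters. Paths of [G] avoiding their vertices [S'] lift to
    connect the intact clusters ([Rgood]), and every surviving dart reaches an intact cluster
    ([toGood]). *)
Lemma trunc_connected : k_connected G 3 -> k_connected trunc 3.
Proof.
move=> [G3 conn]; split=> [|S S2]; first exact: leq_trans leq_card_trunc.
pose S' := tail @: S.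
have S'2 : #|S'| < 3 by apply: leq_ltn_trans S2; apply: leq_imset_card.
pose R := connect (@adj_avoiding trunc S).
have Radj d d' : d \notin S -> d' \notin S -> trunc_adj d d' -> R d d'.
  by move=> dS d'S dd'; apply: connect1; apply/and3P.
have notS d : tail d \notin S' -> d \notin S by apply: contra => dS; apply: imset_f.
have Rgood d d' : tail d \notin S' -> tail d' \notin S' -> R d d'.
  move=> dS d'S.
  have Rtail e e' : tail e \notin S' -> tail e = tail e' -> R e e'.
    move=> eS ee'; have [->|ne] := eqVneq e e'; first exact: connect0.
    by apply: Radj; rewrite ?notS // -?ee' // /trunc_adj ee' eqxx ne.
  have /connectP[p] : connect (adj_avoiding S') (tail d) (tail d').
    by apply: conn; rewrite // inE.
  elim: p d dS => [|w p IH] d dS /=; first by move=> _ E; apply: Rtail.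
  move=> /andP[/and3P[_ wS dw]] pth E.
  have step1 : R d (Dart dw) by apply: Rtail.
  have step2 : R (Dart dw) (rev_dart (Dart dw)).
    by apply: Radj; [exact: notS|exact: notS|exact: trunc_adj_rev].
  have step3 : R (rev_dart (Dart dw)) d' by apply: IH.
  exact: connect_trans step1 (connect_trans step2 step3).
have toGood d : d \notin S -> exists2 d', tail d' \notin S' & R d d'.
  move=> dS; have [/imsetP[e eS de]|] := boolP (tail d \in S'); last first.
    by move=> dS'; exists d; last exact: connect0.
  have [/imsetP[e' e'S de']|dS'] := boolP (head d \in S'); last first.
    by exists (rev_dart d); last by apply: Radj; [|exact: notS|exact: trunc_adj_rev].
  (* Both ends of [d] are spoiled, so [S] is exactly one dart at each end. The third dart [t] at the
     tail of [d] thus survives, and its head avoids both ends since [G] is simple. *)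
  have SE : [set e; e'] = S.
    apply/eqP; rewrite eqEcard subUset !sub1set eS e'S cards2.
    suff -> : e != e' by [].
    by apply/eqP => ee'; have := tail_neq_head d; rewrite de de' ee' eqxx.
  have de_neq : d != e by apply: contraNneq dS => ->.
  have [t [td tnd tne _]] := third_dart de de_neq.
  have tS : t \notin S.
    rewrite -SE !inE (negPf tne) /=; apply/eqP => te'.
    by have := tail_neq_head d; rewrite de' -te' td eqxx.
  have htS : head t \notin S'.
    apply/imsetP => -[x]; rewrite -SE !inE => /orP[]/eqP-> E.
      by have := tail_neq_head t; rewrite E td de eqxx.
    by case/eqP: tnd; apply: dart_eqP; rewrite // E -de'.
  exists (rev_dart t) => //.
  have dt : R d t by apply: Radj; rewrite // /trunc_adj td eqxx eq_sym tnd.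
  apply: connect_trans dt (Radj _ _ _ _ (trunc_adj_rev _)) => //.
  exact: notS.
have Rsym x y : R x y = R y x.
  exact/sym_connect_sym/adj_avoiding_sym.
move=> x y; rewrite !inE => xS yS.
have [x' x'S xx'] := toGood _ xS; have [y' y'S yy'] := toGood _ yS.
by apply: connect_trans xx' (connect_trans (Rgood _ _ x'S y'S) _); rewrite -/R Rsym.
Qed.

(** * Contracting Hamiltonian cycles, and recovering them by expansion *)

Definition ends (d : dart) : {set G} := [set tail d; head d].

Lemma ends_rev (d : dart) : ends (rev_dart d) = ends d.
Proof. exact: setUC. Qed.

Lemma ends_eqP (d d' : dart) : ends d = ends d' -> d' = d \/ d' = rev_dart d.
Proof.
by move/set2_eqP => [[t h]|[t h]]; [left|right]; apply: dart_eqP.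
Qed.

Definition contract (C : {set {set dart}}) : {set {set G}} :=
  [set ends d | d : dart & [set d; rev_dart d] \in C].

(* The edge set of the only Hamiltonian cycle of the truncation that can contract
   to [E]. *)
Definition expand_rel (E : {set {set G}}) : rel dart :=
  [rel d d' | trunc_adj d d' &&
    if tail d == tail d' then ~~ ((ends d \in E) && (ends d' \in E))
    else ends d \in E].

Definition expand (E : {set {set G}}) : {set {set dart}} :=
  [set [set p.1; p.2] | p : dart * dart & expand_rel E p.1 p.2].

Section ContractHamiltonian.
Variable f : dart -> dart.
Hypothesis fadj : forall d, trunc_adj d (f d).
Hypothesis ftr : forall d d', fconnect f d d'.
Hypothesis card_dart : 3 < #|{: dart}|.

Let C : {set {set dart}} := [set [set d; f d] | d : dart].

Let finj : injective f.
Proof. by apply: transitive_inj ftr (ltnW (ltnW card_dart)). Qed.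

Let f2 d : f (f d) <> d.
Proof. by apply/eqP/transitive_no_2cycle=> //; apply: ltnW. Qed.

Let f_inside d : f d <> rev_dart d -> tail (f d) = tail d /\ f d <> d.
Proof.
move=> nr; have /orP[/andP[/eqP-> /eqP/nesym nd]|/eqP] := fadj d; by [].
Qed.

Let f_pre d : exists2 p, f p = d & [\/ p = rev_dart d | tail p = tail d /\ p <> d].
Proof.
exists (finv f d); first exact: f_finv.
have := fadj (finv f d); rewrite f_finv //.
by move=> /orP[/andP[/eqP-> /eqP nd]|/eqP {2}->]; [right|left; rewrite rev_dartK].
Qed.

(* Otherwise the successor function would never leave the triangle at [u]. *)
Lemma exit_exists u : exists d, (tail d == u) && (f d == rev_dart d).
Proof.
apply/existsP/existsPn => noexit.
have [d0 d0u] := dart_at u.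
have full d : d \in cluster u.
  apply: (fclosed_full ftr (x := d0)); first by rewrite inE.
  move=> x; rewrite !inE => /eqP xu; have := noexit x; rewrite xu eqxx /= => /eqP.
  by move/f_inside => [-> _]; rewrite xu.
have : #|{: dart}| <= #|cluster u| by apply/subset_leq_card/subsetP => d _.
by rewrite card_cluster leqNgt card_dart.
Qed.

(* Two exits would both have the third dart of the triangle as predecessor. *)
Lemma exit_unique d d' :
  tail d = tail d' -> f d = rev_dart d -> f d' = rev_dart d' -> d = d'.
Proof.
move=> tt fd fd'; apply/eqP/negPn/negP => nd.
have [t [_ _ _ all3]] := third_dart tt nd.
have [p fp [E|[tp np]]] := f_pre d; first by case: (@f2 d); rewrite fd -E.
have [p' fp' [E|[tp' np']]] := f_pre d'; first by case: (@f2 d'); rewrite fd' -E.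
have pt : p = t.
  case: (all3 p tp) => // E.
  by case: (@tail_rev d'); rewrite -fd' -E fp.
have p't : p' = t.
  case: (all3 p' (etrans tp' (esym tt))) => // E.
  by case: (@tail_rev d); rewrite -fd -E fp'.
by case/eqP: nd; rewrite -fp -fp' pt p't.
Qed.

(** The corner at which the cycle leaves the triangle at [u]; [g u] is then the next vertex of the
    contracted cycle. *)
Let exit u := xchoose (exit_exists u).
Let g u := head (exit u).

Let exit_tail u : tail (exit u) = u.
Proof. by have /andP[/eqP] := xchooseP (exit_exists u). Qed.

Let f_exit u : f (exit u) = rev_dart (exit u).
Proof. by have /andP[_ /eqP] := xchooseP (exit_exists u). Qed.

Let exitE d : f d = rev_dart d -> exit (tail d) = d.
Proof. by move=> fd; apply: exit_unique; rewrite ?exit_tail. Qed.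

Lemma mem_contract d :
  (ends d \in contract C) <-> f d = rev_dart d \/ f (rev_dart d) = d.
Proof.
have inC x : [set x; rev_dart x] \in C -> f x = rev_dart x \/ f (rev_dart x) = x.
  move=> /imsetP[y _ /set2_eqP[[<- ->]|[E Er]]]; first by left.
  by right; rewrite Er E.
split=> [/imsetP[x]|].
  rewrite inE => /inC xC /ends_eqP[] E; move: xC; rewrite E ?rev_dartK //.
  by case; auto.
move=> fd; apply/imsetP; exists d => //; rewrite inE; apply/imsetP.
by case: fd => fd; [exists d|exists (rev_dart d)]; rewrite // fd // setUC.
Qed.

(** Each [f]-step either stays inside a triangle or is an exit and projects to a [g]-step, so
    transitivity of [f] passes to [g]. *)
Lemma contract_hamiltonian : hamiltonian_cycle (contract C).
Proof.
apply/hamiltonian_cycleP.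
have /card_gt0P[d0 _] : 0 < #|{: dart}| by apply: leq_trans card_dart.
split; first by apply: ltnW; apply: card_cubic (tail d0).
exists g; split=> [u|u v|].
- by rewrite -{1}(exit_tail u) adj_dart.
- have [d /eqP <-] := dart_at u; have [d' /eqP <-] := dart_at v.
  have /iter_findex <- := ftr d d'.
  elim: (findex f d d') => [|n IH] /=; first exact: connect0.
  apply: connect_trans IH _; set x := iter n f d.
  have [fx|/eqP/f_inside[-> _]] := eqVneq (f x) (rev_dart x); last exact: connect0.
  by rewrite fx; apply: connect1; rewrite /= /g exitE.
apply/setP => e; apply/idP/imsetP => [/imsetP[d]|[u _ ->]].
  rewrite inE => dC ->.
  have /mem_contract[fd|fd] : ends d \in contract C by apply: imset_f; rewrite inE.
    by exists (tail d); rewrite // /g exitE.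
  by exists (head d); rewrite // /g (@exitE (rev_dart d)) ?rev_dartK // -ends_rev.
rewrite -{1}(exit_tail u) -/(ends (exit u)).
by apply/mem_contract; left.
Qed.

Let pass d d' : tail d = tail d' -> d != d' -> f d = rev_dart d ->
  ends d' \notin contract C -> f d' = d.
Proof.
move=> tt nd fd d'C.
have nE : ~ (f d' = rev_dart d' \/ f (rev_dart d') = d').
  by move/mem_contract; apply/negP.
have [t [td tnd tnd' all3]] := third_dart tt nd.
have [|tf nf] := @f_inside d'; first by move=> E; apply: nE; left.
case: (all3 (f d') (etrans tf (esym tt))) => [//|E|ft]; first by case: nf.
have [p fp [E|[tp np]]] := f_pre d'; first by case: nE; right; rewrite -E.
case: (all3 p (etrans tp (esym tt))) => [E|E|E] //.
  by case: (@tail_rev d); rewrite -fd -E fp.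
by case: (@f2 d'); rewrite ft -E fp.
Qed.

(** The one triangle edge missed by the cycle joins the entry and exit corners, exactly the corners
    whose outer edges are used. Hence [C] is determined by its contraction. *)
Lemma expandK_contract : expand (contract C) = C.
Proof.
apply/setP => e; apply/imsetP/imsetP => [[[d d'] /=]|[x _ ->]]; last first.
  exists (x, f x) => //; rewrite inE; apply/andP; split=> /=; first exact: fadj.
  have [tt|nt] := eqVneq (tail x) (tail (f x)); last first.
    apply/mem_contract; left.
    have [->|/eqP/f_inside[E _]] := eqVneq (f x) (rev_dart x) => //.
    by rewrite E eqxx in nt.
  apply/negP => /andP[/mem_contract[E|Ex] /mem_contract Ey].
    by case: (@tail_rev x); rewrite -E.
  case: Ey => [Ey|/finj Ey]; last by case: (@tail_rev (f x)); rewrite Ey.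
  have nx : x != f x by apply/eqP => E; case: (@f2 x); rewrite -!E.
  (* Here [x] is the entry and [f x] the exit. The third corner [t] is no exit, so its successor
     stays in the triangle, yet it can be none of the three corners. *)
  have [t [tx tnx tny all3]] := third_dart tt nx.
  have [|tft nft] := @f_inside t.
    by move=> ft; case/eqP: tny; apply: exit_unique; rewrite // tx.
  case: (all3 (f t) (etrans tft tx)) => [E|/finj E|//].
    by case: (@tail_rev x); rewrite -tx; congr tail; apply: finj; rewrite E.
  by rewrite E eqxx in tnx.
rewrite inE /expand_rel /= => + ->; case/andP=> /orP[/andP[tt nd]|/eqP->]; last first.
  rewrite eq_sym; case: eqP => [/tail_rev//|_] /mem_contract[E|E].
    by exists d; rewrite // E.
  by exists (rev_dart d); rewrite // E setUC.
rewrite tt => nE; move/eqP: tt => tt.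
suff [<-|<-] : f d = d' \/ f d' = d by [exists d|exists d'; rewrite // setUC].
have inC x : f x = rev_dart x -> ends x \in contract C.
  by move=> fx; apply/mem_contract; left.
have [fd|/eqP nfd] := eqVneq (f d) (rev_dart d).
  by right; apply: (pass tt nd fd); apply: contra nE => ->; rewrite inC.
have [fd'|/eqP nfd'] := eqVneq (f d') (rev_dart d').
  left; apply: (pass (esym tt) _ fd'); first by rewrite eq_sym.
  by apply: contra nE => ->; rewrite inC.
(* Neither corner is an exit. If neither were the successor of the other, both would be sent to [t],
   against injectivity. *)
have [t [td tnd tnd' all3]] := third_dart tt nd.
have [tf nf] := f_inside nfd; have [tf' nf'] := f_inside nfd'.
case: (all3 _ tf) => // [E|ft]; first by left.
case: (all3 _ (etrans tf' (esym tt))) => [E|//|ft']; first by right.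
by case/eqP: nd; apply: finj; rewrite ft ft'.
Qed.

End ContractHamiltonian.

(** * Lifting a Hamiltonian cycle to the truncation *)

Section LiftHamiltonian.
Variable g : G -> G.
Hypothesis gadj : forall u, adj u (g u).
Hypothesis gtr : forall u v, fconnect g u v.
Hypothesis G2 : 2 < #|G|.

Let ginj : injective g.
Proof. exact: transitive_inj gtr (ltnW G2). Qed.

Let adj_finv u : adj u (finv g u).
Proof. by rewrite adj_sym -{2}(f_finv ginj u). Qed.

Let exit u : dart := Dart (gadj u).
Let entry u : dart := Dart (adj_finv u).

(** Equality would make the predecessor and the successor of [u] coincide, a 2-cycle of [g]. *)
Let entry_exit u : entry u != exit u.
Proof.
apply/eqP => /(congr1 head) E; have {}E : finv g u = g u by [].
by have := transitive_no_2cycle gtr G2 u; rewrite -E f_finv ?eqxx.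
Qed.

Let middle_exists u :
  exists m, [&& tail m == u, m != entry u & m != exit u].
Proof.
have [|m [tm n1 n2 _]] := third_dart _ (entry_exit u) => //.
by exists m; rewrite tm eqxx n1.
Qed.

Let middle u := xchoose (middle_exists u).

Let cluster_cases d :
  [\/ d = entry (tail d), d = exit (tail d) | d = middle (tail d)].
Proof.
have /and3P[/eqP tm n1 n2] := xchooseP (middle_exists (tail d)).
have [|m [_ _ _ all3]] := third_dart _ (entry_exit (tail d)) => //.
rewrite -/(middle _) in tm n1 n2.
have := all3 (middle (tail d)) tm.
case=> E; rewrite ?E ?eqxx // in n1 n2 *.
exact: all3.
Qed.

(** Runs through each triangle as entry, middle, exit, and then crosses to the entry of the triangle
    at [g u]. *)
Let f (d : dart) : dart :=
  if d == exit (tail d) then rev_dart d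
  else if d == entry (tail d) then middle (tail d) else exit (tail d).

Let f_exit u : f (exit u) = entry (g u).
Proof.
rewrite /f eqxx; apply: dart_eqP => //.
by rewrite -[RHS]/(finv g (g u)) finv_f.
 Qed.

Let f_entry u : f (entry u) = middle u.
Proof. by rewrite /f (negPf (entry_exit u)) eqxx. Qed.

Let tail_middle u : tail (middle u) = u.
Proof. by have /and3P[/eqP] := xchooseP (middle_exists u). Qed.

Let f_middle u : f (middle u) = exit u.
Proof.
rewrite /f tail_middle; have /and3P[_ n1 n2] := xchooseP (middle_exists u).
by rewrite (negPf n1) (negPf n2).
Qed.

Lemma lift_hamiltonian : exists C, @hamiltonian_cycle trunc C.
Proof.
have c1 d : fconnect f d (f d) by apply: connect1 => /=.
have cm u : fconnect f (middle u) (exit u) by rewrite -f_middle.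
have ci u : fconnect f (entry u) (middle u) by rewrite -f_entry.
have ce u : fconnect f (exit u) (entry (g u)) by rewrite -f_exit.
have toexit d : fconnect f d (exit (tail d)).
  case: (cluster_cases d) => {1}->.
  - exact: connect_trans (ci _) (cm _).
  - exact: connect0.
  - exact: cm.
have exits u v : fconnect f (exit u) (exit v).
  have /iter_findex <- := gtr u v.
  elim: (findex g u v) => [|n IH] /=; first exact: connect0.
  exact: connect_trans IH (connect_trans (ce _) (toexit _)).
exists [set [set d; f d] | d : dart]; apply/hamiltonian_cycleP.
split; first exact: leq_trans leq_card_trunc.
exists f; split=> // [d|d d'].
  rewrite /f; have [_|n1] := eqVneq d (exit (tail d)); first exact: trunc_adj_rev.
  have [E|n2] := eqVneq d (entry (tail d)); rewrite /= /trunc_adj; last by rewrite eqxx n1.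
  have /and3P[_ n _] := xchooseP (middle_exists (tail d)).
  by rewrite tail_middle eqxx {1}E eq_sym n.
apply: connect_trans (toexit d) _.
(* The triangle of [d'] is entered from that of the [g]-predecessor [u] of its vertex. *)
have [u tu] : exists u, tail d' = g u by exists (finv g (tail d')); rewrite f_finv.
have cu := connect_trans (exits (tail d) u) (ce u).
case: (cluster_cases d') => ->; rewrite ?tu //.
exact: connect_trans cu (ci _).
Qed.

End LiftHamiltonian.

(** * Lifting automorphisms and transferring Hamiltonian transitivity *)

Section LiftAutomorphism.
Variable s : {perm G}.
Hypothesis s_aut : s \in graph_aut G.

Let lift_adj (d : dart) : adj (s (tail d)) (s (head d)).
Proof. by rewrite (graph_autP _ s_aut) adj_dart. Qed.

Let lift_fun (d : dart) : dart := Dart (lift_adj d).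

Let lift_inj : injective lift_fun.
Proof.
move=> d d' E; apply: dart_eqP; apply: (@perm_inj _ s).
  by have := congr1 tail E.
by have := congr1 head E.
Qed.

Lemma lift_aut : exists2 t : {perm trunc}, t \in graph_aut trunc &
  forall d : dart, tail (t d) = s (tail d) /\ head (t d) = s (head d).
Proof.
exists (perm lift_inj : {perm trunc}) => [|d]; last by rewrite permE.
apply/graph_autP => d d'; rewrite !permE /= /trunc_adj (inj_eq lift_inj).
rewrite [tail _ == _](inj_eq perm_inj); congr (_ || _).
have E : lift_fun (rev_dart d) = rev_dart (lift_fun d) by apply: dart_eqP.
by rewrite -E (inj_eq lift_inj).
Qed.

End LiftAutomorphism.

End Truncation.

Lemma act_set1E (T : finType) (s : {perm T}) (A : {set T}) : ('P^*)%act A s = s @: A.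
Proof. by rewrite /= setactE; apply: eq_imset => x. Qed.

Lemma act_set2E (T : finType) (s : {perm T}) (C : {set {set T}}) :
  ('P^*^*)%act C s = [set s @: e | e : {set T} in C].
Proof. by rewrite /= setactE; apply: eq_imset => e; apply: act_set1E. Qed.

Lemma imset_set2 (T U : finType) (f : T -> U) (x y : T) :
  f @: [set x; y] = [set f x; f y].
Proof. by rewrite imsetU1 imset_set1. Qed.

(** Expansion is defined only from adjacency, tails and membership of [ends d] in [E], all of which
    are carried along by [s] and its lift [t]. *)
Lemma expand_lift (G : sgraph) (E : {set {set G}}) (s : {perm G}) (t : {perm trunc G}) :
  t \in graph_aut (trunc G) ->
  (forall d : dart G, tail (t d) = s (tail d) /\ head (t d) = s (head d)) ->
  expand [set s @: e | e : {set G} in E] = [set t @: e | e : {set trunc G} in expand E].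
Proof.
move=> t_aut ts.
pose sE := [set s @: e | e : {set G} in E]; rewrite -/sE.
have memE (d : dart G) : (ends (t d) \in sE) = (ends d \in E).
  rewrite /ends; have [-> ->] := ts d; rewrite -imset_set2 mem_imset //.
  exact: imset_inj perm_inj.
have relE (d d' : dart G) : expand_rel sE (t d) (t d') = expand_rel E d d'.
  rewrite /expand_rel /= !memE; have [-> _] := ts d; have [-> _] := ts d'.
  by rewrite (inj_eq perm_inj); have /= -> := graph_autP _ t_aut d d'.
apply/setP => e; apply/imsetP/imsetP => [[[d d']]|[x /imsetP[[d d']]]].
  rewrite inE => /= dd' ->.
  exists [set t^-1 d; t^-1 d']; last by rewrite imset_set2 !permKV.
  by apply/imsetP; exists (t^-1 d, t^-1 d'); rewrite // inE /= -relE !permKV.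
rewrite inE => /= dd' -> ->; exists (t d, t d'); last exact: imset_set2.
by rewrite inE [X in is_true X]relE.
Qed.

(** Two cycles of the truncation are the expansions of their contractions; an automorphism of [G]
    matching the contractions lifts to one matching the cycles. *)
Lemma trunc_transitive (G : sgraph) :
  cubic G -> hamiltonian_transitive G -> hamiltonian_transitive (trunc G).
Proof.
move=> cubicG [[E0 HE0] tr]; split.
  have /hamiltonian_cycleP[G2 [g [gadj gtr _]]] := HE0.
  exact: lift_hamiltonian gadj gtr G2.
have ham C : @hamiltonian_cycle (trunc G) C ->
    hamiltonian_cycle (contract C) /\ expand (contract C) = C.
  move=> /hamiltonian_cycleP[T2 [f [fadj ftr ->]]].
  have T3 : 3 < #|{: dart G}|.
    have /card_gt0P[d _] : 0 < #|trunc G| by apply: leq_trans T2.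
    exact: leq_trans (card_cubic cubicG (tail d)) (leq_card_trunc cubicG).
  by split; [apply: contract_hamiltonian|apply: expandK_contract].
move=> C D /ham[HC EC] /ham[HD ED].
have [s s_aut sCD] := tr _ _ HC HD.
have [t t_aut ts] := lift_aut s_aut; exists t => //.
by rewrite -EC -ED -sCD !act_set2E (expand_lift _ t_aut ts).
Qed.

(** * Descending automorphisms and counting edge orbits *)

Section EdgeOrbits.
Variable G : sgraph.
Hypothesis cubicG : cubic G.

(* Edges between distinct triangles have no common neighbour, so being in the same
   triangle is a graph invariant. *)
Lemma same_tailE (d d' : dart G) :
  (tail d == tail d') = (d == d') ||
    [&& adj (d : trunc G) d' &
      [exists t : trunc G, adj (d : trunc G) t && adj (d' : trunc G) t]].
Proof.
have [->|nd] := eqVneq d d'; first by rewrite eqxx.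
apply/eqP/andP => [tt|[dd' /existsP[t /andP[dt d't]]]].
  have [t [td tnd tnd' _]] := third_dart cubicG tt nd.
  split; first by rewrite /= /trunc_adj tt eqxx nd.
  by apply/existsP; exists t; rewrite /= /trunc_adj td -tt eqxx !(eq_sym _ t) tnd tnd'.
move: dd' dt d't => /orP[/andP[/eqP//]|/eqP->].
case/orP=> [/andP[/eqP dt ndt]|/eqP->]; last by rewrite adj_irrefl.
case/orP=> [/andP[/eqP d't _]|/eqP E]; first by case: (@tail_rev _ d); rewrite d't.
by rewrite E rev_dartK eqxx in ndt.
Qed.

Let vertex_dart (u : G) : dart G := xchoose (dart_at cubicG u).

Let tail_vertex_dart u : tail (vertex_dart u) = u.
Proof. by have /eqP := xchooseP (dart_at cubicG u). Qed.

Let induced (t : {perm trunc G}) (u : G) : G := tail (t (vertex_dart u)).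

Let aut_tail t : t \in graph_aut (trunc G) ->
  forall d d' : dart G, (tail (t d) == tail (t d')) = (tail d == tail d').
Proof.
move=> /graph_autP t_aut d d'; rewrite !same_tailE t_aut (inj_eq perm_inj).
congr (_ || (_ && _)); apply/existsP/existsP => -[x /andP[dx d'x]].
  by exists (t^-1 x); rewrite -!(t_aut _ (t^-1 x)) permKV dx.
by exists (t x); rewrite !t_aut dx.
Qed.

Let tail_induced t (d : dart G) :
  t \in graph_aut (trunc G) -> tail (t d) = induced t (tail d).
Proof. by move=> t_aut; apply/eqP; rewrite aut_tail // tail_vertex_dart. Qed.

Let inducedK t : t \in graph_aut (trunc G) -> cancel (induced t) (induced t^-1).
Proof.
move=> t_aut u; rewrite -tail_induced ?groupV //.
by rewrite permK tail_vertex_dart.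
Qed.

(** The reverse of [d] is its only neighbour outside its own triangle, and automorphisms preserve
    triangles. *)
Let aut_rev t (d : dart G) :
  t \in graph_aut (trunc G) -> t (rev_dart d) = rev_dart (t d).
Proof.
move=> t_aut; have := graph_autP _ t_aut d (rev_dart d).
rewrite trunc_adj_rev => /orP[/andP[]|/eqP//].
by rewrite aut_tail // eq_sym => /eqP/tail_rev.
Qed.

Let induced_adj t u v :
  t \in graph_aut (trunc G) -> adj u v -> adj (induced t u) (induced t v).
Proof.
move=> t_aut uv; have := adj_dart (t (Dart uv)).
rewrite -[head _]/(tail (rev_dart _)) -aut_rev //.
by rewrite !tail_induced.
Qed.

Lemma induced_aut t : t \in graph_aut (trunc G) ->
  exists2 s : {perm G}, s \in graph_aut G &
    forall d : dart G, tail (t d) = s (tail d).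
Proof.
move=> t_aut; exists (perm (can_inj (inducedK t_aut))) => [|d]; last first.
  by rewrite permE tail_induced.
apply/graph_autP => u v; rewrite !permE.
apply/idP/idP; last exact: induced_adj.
move/(induced_adj (groupVr t_aut)).
by rewrite !inducedK.
Qed.

Let old_edge (d : dart G) : {set trunc G} :=
  [set (d : trunc G); (rev_dart d : trunc G)].

(** The orbit [X0] of a triangle edge is set aside, and the remaining orbits are shown to cover the
    edge orbits of [G] under [psi]. *)
Lemma trunc_orbits (x : G) : #|edge_orbits G| < #|edge_orbits (trunc G)|.
Proof.
have [d0 _] := dart_at cubicG x.
have [d1 d01 nd] := other_dart cubicG d0.
pose X0 := orbit ('P^*)%act (graph_aut (trunc G)) [set (d0 : trunc G); (d1 : trunc G)].
have X0_in : X0 \in edge_orbits (trunc G).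
  apply/imset_f/imsetP; exists (d0 : trunc G, d1 : trunc G) => //.
  by rewrite inE /= /trunc_adj d01 eqxx eq_sym nd.
(* Projects an arbitrary representative by [tail]. Only values at orbits of old edges matter, so
   [set0] is a mere default. *)
pose psi (X : {set {set trunc G}}) : {set {set G}} :=
  orbit ('P^*)%act (graph_aut G) (@tail G @: odflt set0 [pick e in X]).
rewrite (cardsD1 X0) X0_in add1n ltnS.
apply: leq_trans (leq_imset_card psi _); apply/subset_leq_card/subsetP => O.
case/imsetP => e /imsetP[[u v]]; rewrite inE /= => uv -> ->.
pose d := Dart uv; pose X := orbit ('P^*)%act (graph_aut (trunc G)) (old_edge d).
apply/imsetP; exists X.
  rewrite !inE; apply/andP; split; last first.
    apply/imset_f/imsetP; exists (d : trunc G, rev_dart d : trunc G) => //.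
    by rewrite inE trunc_adj_rev.
  apply/eqP => XX0.
  (* Images of an old edge are again pairs of reverse darts, with distinct tails, whereas [d0] and
     [d1] share a tail. *)
  have : [set (d0 : trunc G); (d1 : trunc G)] \in X by rewrite XX0 orbit_refl.
  case/orbitP => t t_aut; rewrite act_set1E imset_set2 aut_rev // => /set2_eqP E.
  by case: (@tail_rev _ (t d)); case: E => -[-> ->].
(* The choice is harmless: another representative is [t] applied to [old_edge d], and it projects to
   the image of the edge under the induced automorphism [s]. *)
rewrite /psi; case: pickP => [e'|/(_ (old_edge d))]; last by rewrite orbit_refl.
case/orbitP => t t_aut <- /=; rewrite act_set1E imset_set2 imset_set2.
have [s s_aut st] := induced_aut t_aut.
rewrite !st -imset_set2 -act_set1E; apply/esym/orbit_eqP.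
by apply: mem_orbit.
Qed.

End EdgeOrbits.

(** * The base case and the iteration *)

Definition K4_adj (x y : bool * bool) : bool := x != y.

Lemma K4_adj_sym : symmetric K4_adj.
Proof. by move=> x y; rewrite /K4_adj eq_sym. Qed.

Lemma K4_adj_irrefl : irreflexive K4_adj.
Proof. by move=> x; rewrite /K4_adj eqxx. Qed.

Definition K4 : sgraph := SGraph K4_adj_sym K4_adj_irrefl.

Lemma K4_cubic : cubic K4.
Proof.
move=> x; rewrite (_ : [set y | _] = [set~ x]).
  by rewrite cardsC1 card_prod card_bool.
by apply/setP => y; rewrite !inE /= /K4_adj eq_sym.
Qed.

Lemma K4_connected : k_connected K4 3.
Proof.
split=> [|S _ x y]; first by rewrite card_prod card_bool.
rewrite !inE => xS yS; have [->|xy] := eqVneq x y; first exact: connect0.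
by apply: connect1; apply/and3P.
Qed.

(** Every permutation of the vertices is an automorphism, so matching two cyclic sequences position
    by position suffices. *)
Lemma K4_transitive : hamiltonian_transitive K4.
Proof.
split.
  exists (@cycle_edges K4
    [:: (true, true); (true, false); (false, false); (false, true)]).
  by eexists; split; last reflexivity; [| |case=> [] [] []].
move=> C D [c [_ /andP[_ uc] allc ->]] [c' [_ /andP[_ uc'] allc' ->]].
have cc' : size c = size c'.
  by apply/perm_size/uniq_perm => // x; rewrite allc allc'.
pose x0 : K4 := (true, true); pose f x := nth x0 c' (index x c).
have finj : injective f.
  move=> x y /eqP; rewrite nth_uniq -?cc' ?index_mem ?allc //.
  by move/eqP/(congr1 (nth x0 c)); rewrite !nth_index.
have fc : map f c = c'.
  apply: (@eq_from_nth _ x0); rewrite size_map // => i ic.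
  by rewrite (nth_map x0) // /f index_uniq.
exists (perm finj).
  by apply/graph_autP => x y; rewrite /= /K4_adj !permE (inj_eq finj).
rewrite act_set2E /cycle_edges -imset_comp -fc.
apply/setP => e; apply/imsetP/imsetP => -[x xc ->].
  exists (f x); first exact: map_f.
  by rewrite /= imset_set2 !permE next_map.
case/mapP: xc => y yc ->; exists y => //.
by rewrite /= imset_set2 !permE next_map.
Qed.

Theorem proposition34 :
  exists F : sgraph -> Prop,
    (forall G : sgraph, F G ->
       [/\ cubic G, k_connected G 3 & hamiltonian_transitive G]) /\
    (forall N : nat, exists G : sgraph, F G /\ N <= #|edge_orbits G|).
Proof.
(* The class of all such graphs makes the first clause immediate; iterated truncations of [K4]
   witness the second, gaining at least one orbit each time. *)
exists (fun G => [/\ cubic G, k_connected G 3 & hamiltonian_transitive G]).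
split=> // N; elim: N => [|N [G [[cG kG hG] NG]]].
  exists K4; split=> //.
  by split; [apply: K4_cubic|apply: K4_connected|apply: K4_transitive].
exists (trunc G); split.
  by split; [apply: trunc_cubic|apply: trunc_connected|apply: trunc_transitive].
have /card_gt0P[x _] : 0 < #|G| by case: kG => G3 _; apply: leq_trans G3.
exact: leq_ltn_trans NG (trunc_orbits cG x).
Qed.
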